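(* Let $1\leq p<\infty$ and let $f:[0,1]\to\mathcal{L}^p(\Omega)$, $t\mapsto f_t$, be a continuous map. If $f_t$ is a continuous function on $\Omega$ for every $t\in[0,1]$, then there is a comeagre subset $T\subset[0,1]$ such that for any $t\in T$ and any sequence $(t_n)_{n\in\mathbb{N}}$ in $[0,1]$ with limit $t$, $$\lim_{n\to\infty}f_{t_n}(x)=f_t(x)\quad\text{for all }x\in\Omega.$$
   Context: $\Omega=[0,1]$ with its Borel $\sigma$-field and Lebesgue measure. $\mathcal{L}^p(\Omega)$ is the space of real-valued $p$-integrable functions on $\Omega$, where almost everywhere equal functions are NOT identified, equipped with the topology induced by the seminorm $\|\cdot\|_p$; continuity of $f:[0,1]\to\mathcal{L}^p(\Omega)$ is with respect to this topology. *)

(* Defs.v *)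
From HB Require Import structures.
From mathcomp Require Import all_boot all_order all_algebra.
From mathcomp Require Import all_classical all_reals all_analysis.

Set Implicit Arguments.
Unset Strict Implicit.
Unset Printing Implicit Defensive.
Import Order.TTheory GRing.Theory Num.Theory.
Import numFieldNormedType.Exports.

Local Open Scope classical_set_scope.
Local Open Scope ring_scope.

Section Category.
Context {X : topologicalType}.
Implicit Type A : set X.

Definition nowhere_dense A := (closure A)° = set0.

Definition meagre A :=
  exists2 F : (set X)^nat, (forall n, nowhere_dense (F n)) & A = \bigcup_n F n.

Definition comeagre A := meagre (~` A).

End Category.

(* The interval [0, 1] as a type of its own, so that its topology (that of the
   subtype), its Borel sets and the functions defined on it do not involve the
   ambient line. *)
Definition unit_interval (R : realType) : Type :=
  set_type (`[0, 1]%classic : set R).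

Section UnitInterval.
Variable R : realType.
Local Notation I := (unit_interval R).

HB.instance Definition _ :=
  PseudoMetric.copy I (set_type (`[0, 1]%classic : set R)).

Fact unit_interval0_subproof : (0 : R) \in (`[0, 1]%classic : set R).
Proof. by rewrite inE /= in_itv /= lexx ler01. Qed.

Definition unit_interval0 : I := exist _ (0 : R) unit_interval0_subproof.

HB.instance Definition _ := isPointed.Build I unit_interval0.

HB.instance Definition _ := Measurable.copy I (g_sigma_algebraType (@open I)).

Definition unit_interval_val (x : I) : R := set_val x.

Lemma unit_interval_val_inj : injective unit_interval_val.
Proof. exact: val_inj. Qed.

Lemma image_unit_interval_measurable (A : set I) :
  measurable A -> measurable (unit_interval_val @` A).
Proof.
pose G : set (set I) := [set A | measurable (unit_interval_val @` A)].
have imT : unit_interval_val @` setT = `[0, 1]%classic.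
  apply/seteqP; split=> [_ [[x xI] _ <-]|x xI]; first exact: set_mem.
  by exists (exist _ x (mem_set xI)).
suff : <<s @open I >> `<=` G by apply.
apply: smallest_sub.
  split.
  - by rewrite /G /= image_set0.
  - move=> B mB; rewrite /G /= [X in measurable X](_ : _ =
      `[0, 1]%classic `\` (unit_interval_val @` B)).
      by apply: measurableD => //; exact: measurable_itv.
    rewrite -imT; apply/seteqP; split=> [_ [x [_ Bx] <-]|_ [[x _ <-] Bx]].
      split; first by exists x.
      by move=> [y By /unit_interval_val_inj yx]; rewrite -yx in Bx.
    by exists x => //; split=> // xB; apply: Bx; exists x.
  - by move=> F mF; rewrite /G /= image_bigcup; exact: bigcupT_measurable.
move=> _ [B oB <-]; rewrite /G /=.
rewrite [X in measurable X](_ : _ = `[0, 1]%classic `&` B).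
  apply: measurableI; first exact: measurable_itv.
  exact: measurable_realfun.open_measurable.
apply/seteqP; split=> [_ [[x xI] /= Bx <-]|x [xI Bx]].
  by split=> //; exact: set_mem.
by exists (exist _ x (mem_set xI)).
Qed.

Definition unit_interval_measure (A : set I) : \bar R :=
  lebesgue_measure (unit_interval_val @` A).

Let unit_interval_measure0 : unit_interval_measure set0 = 0%E.
Proof. by rewrite /unit_interval_measure image_set0 measure0. Qed.

Let unit_interval_measure_ge0 A : (0 <= unit_interval_measure A)%E.
Proof. exact: measure_ge0. Qed.

Let unit_interval_measure_sigma_additive :
  semi_sigma_additive unit_interval_measure.
Proof.
move=> F mF tF _; rewrite /unit_interval_measure image_bigcup.
apply: measure_semi_sigma_additive.
- by move=> n; exact: image_unit_interval_measurable.
- apply/trivIsetP => i j _ _ ij.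
  rewrite -subset0 => _ [[x Fx <-] [y Fy /unit_interval_val_inj yx]].
  have /trivIsetP/(_ i j Logic.I Logic.I ij) := tF.
  by rewrite -subset0; apply; split; [exact: Fx|rewrite -yx].
- by apply: bigcupT_measurable => n; exact: image_unit_interval_measurable.
Qed.

HB.instance Definition _ := isMeasure.Build _ I R unit_interval_measure
  unit_interval_measure0 unit_interval_measure_ge0
  unit_interval_measure_sigma_additive.

End UnitInterval.

(* [LfunType mu p1] consists of functions, not of classes modulo equality
   almost everywhere, hence the norm below is only a seminorm and the topology
   it induces is in general not Hausdorff. *)
Section LfunTopology.
Context d (T : measurableType d) (R : realType).
Variables (mu : {measure set T -> \bar R}) (p : \bar R) (p1 : (1 <= p)%E).
Local Notation L := (LfunType mu p1).

Definition Lfun_seminorm (f : L) : R := fine ('N[mu]_p [EFin \o f]).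

Let Lfun_seminormMn (f : L) n : Lfun_seminorm (f *+ n) = Lfun_seminorm f *+ n.
Proof. exact: Lnormr_natmul. Qed.

HB.instance Definition _ := Num.Zmodule_isSemiNormed.Build R L
  (@ler_LnormD _ _ _ mu p p1 : forall f g, Lfun_seminorm (f + g) <= _)
  Lfun_seminormMn
  (@LnormrN _ _ _ mu p p1 : forall f, Lfun_seminorm (- f) = _).

Definition Lfun_ball (f : L) (e : R) : set L := [set g | `|f - g| < e].

Definition Lfun_ent : set_system (L * L) := entourage_ Lfun_ball.

HB.instance Definition _ := hasNbhs.Build L (nbhs_ Lfun_ent).

Let Lfun_ball_center f (e : R) : 0 < e -> Lfun_ball f e f.
Proof. by move=> e0; rewrite /Lfun_ball /= subrr normr0. Qed.

Let Lfun_ball_sym f g (e : R) : Lfun_ball f e g -> Lfun_ball g e f.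
Proof. by rewrite /Lfun_ball /= distrC. Qed.

Let Lfun_ball_triangle f g h (e1 e2 : R) :
  Lfun_ball f e1 g -> Lfun_ball g e2 h -> Lfun_ball f (e1 + e2) h.
Proof.
move=> fg gh; rewrite /Lfun_ball /= -[f](subrK g) -addrA.
by rewrite (le_lt_trans (ler_normD _ _))// ltrD.
Qed.

HB.instance Definition _ := @Nbhs_isPseudoMetric.Build R L
  Lfun_ent erefl Lfun_ball Lfun_ball_center Lfun_ball_sym Lfun_ball_triangle
  erefl.

End LfunTopology.

(* Main.v *)
Require Import Defs.
From HB Require Import structures.
From mathcomp Require Import all_boot all_order all_algebra.
From mathcomp Require Import all_classical all_reals all_analysis.
From mathcomp Require Import measurable_realfun measurable_fun_approximation.
From mathcomp Require Import ring lra.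

Set Implicit Arguments.
Unset Strict Implicit.
Unset Printing Implicit Defensive.
Import Order.TTheory GRing.Theory Num.Theory.
Import numFieldNormedType.Exports.

Local Open Scope classical_set_scope.
Local Open Scope ring_scope.

(** The exceptional parameters are found by looking at oscillations in the
    space variable. For an open [V] and [e > 0], let [A(V, e)] be the set of
    parameters [t] for which [f t] oscillates by at most [e] on [V].

    Convergence in L^p sees only functions up to almost everywhere equality,
    but every nonempty open set has positive measure, so when [f u] is close
    to [f t] in L^p, every nonempty open set contains a point where [f u] and
    [f t] are close ([Lfun_seminorm_small]). Both halves of the argument
    use continuity in this form. First, [A(V, e)] is closed: a pair of
    points at which the oscillation of [f t] exceeds [e] may be moved inside
    small open sets, so [f u] also oscillates by more than [e] on [V] for [u]
    near [t] ([closed_oscillation_le]). Hence the boundary [A(V, e) `\` A(V, e)°]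
    is closed with empty interior, and the union of these boundaries over a
    countable base of sets [V] and over [e = 1 / (k + 1)] is meagre.

    Let [t] lie outside this union, and fix [x]. Since [f t] is continuous,
    [t] belongs to some [A(V, e)] with [x] in [V] and [e] small, hence to its
    interior. All [f u] with [u] near [t] then oscillate by at most [e] on
    [V], and each is close to [f t] at some point of [V]; so [f u x] is close
    to [f t x] ([comeagre_continuity]). *)

(** * Meagre unions of boundaries *)

Lemma nowhere_dense0 (S : topologicalType) : nowhere_dense (@set0 S).
Proof. by rewrite /nowhere_dense closure0 interior0. Qed.

Lemma nowhere_dense_closed_boundary (S : topologicalType) (A : set S) :
  closed A -> nowhere_dense (A `\` A°).
Proof.
move=> cA; rewrite /nowhere_dense -(closure_id _).1; last first.
  by rewrite setDE; apply: closedI => //; apply: open_closedC; exact: open_interior.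
rewrite setDE interiorI -subset0 => s [As].
by move=> /interior_subset; apply.
Qed.

Lemma meagre_bigcup_countType (S : topologicalType) (J : countType)
    (F : J -> set S) :
  (forall j, nowhere_dense (F j)) -> meagre (\bigcup_j F j).
Proof.
move=> ndF.
exists (fun n => if unpickle n is Some j then F j else set0) => [n|].
  by case: unpickle => [j|]; [exact: ndF|exact: nowhere_dense0].
apply/seteqP; split=> [s [j _ Fjs]|s [n _]].
  by exists (pickle j) => //; rewrite pickleK.
by case: unpickle => [j|//] Fjs; exists j.
Qed.

(** * Families close to a fixed member somewhere in every open set *)

Definition oscillation_le (S X : Type) (R : realType) (F : S -> X -> R)
    (V : set X) (e : R) : set S :=
  [set s | forall x y, V x -> V y -> `|F s x - F s y| <= e].

Section dense_continuity.
Context (S X : topologicalType) (R : realType) (F : S -> X -> R).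
Hypothesis cF : forall s, continuous (F s).
(* Much weaker than continuity of [u |-> F u y] at a fixed [y]: the point [y]
   may depend on [u]. *)
Hypothesis locF : forall (s : S) (x : X) (V : set X) (eta : R),
  0 < eta -> nbhs x V ->
  \forall u \near s, exists2 y, V y & `|F u y - F s y| < eta.

(** The defining inequality is an open condition on its failure: if it fails at
    [x] and [y] for [s], it fails for [u] near [s] at points that depend on
    [u] and are chosen so close to [x] and [y] that [F s] hardly varies. *)
Lemma closed_oscillation_le (V : set X) (e : R) :
  open V -> closed (oscillation_le F V e).
Proof.
move=> oV; rewrite -[oscillation_le _ _ _]setCK; apply: open_closedC.
rewrite openE => s /existsNP[x] /existsNP[y].
move=> /not_implyP[Vx] /not_implyP[Vy] /negP; rewrite -ltNge => exy.
(* Four errors smaller than [eta] will be made: moving [x] and [y], and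
   replacing [F s] by [F u] at each of the two new points. *)
pose eta := (`|F s x - F s y| - e) / 4.
have eta0 : 0 < eta by rewrite divr_gt0// subr_gt0.
have near_pt z : V z -> nbhs z (V `&` [set w | `|F s z - F s w| < eta]).
  move=> Vz; apply: filterI; first exact: open_nbhs_nbhs.
  by have /cvgrPdist_lt/(_ _ eta0) := @cF s z.
have near_x := @locF s _ _ _ eta0 (near_pt _ Vx).
have near_y := @locF s _ _ _ eta0 (near_pt _ Vy).
apply: filterS2 near_x near_y => u [x' [Vx' sx'] ux'] [y' [Vy' sy'] uy'].
move=> /(_ _ _ Vx' Vy'); apply/negP; rewrite -ltNge.
have -> : e = `|F s x - F s y| - 4 * eta by rewrite /eta; lra.
rewrite ltrBlDr.
have -> : F s x - F s y = (F u x' - F u y') + ((F s x - F s x') -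
  (F u x' - F s x') - (F s y - F s y') + (F u y' - F s y')) by ring.
apply: (le_lt_trans (ler_normD _ _)); rewrite ltrD2l.
apply: (le_lt_trans (ler_normD _ _)).
apply: (le_lt_trans (lerD (ler_normB _ _) (lexx _))).
apply: (le_lt_trans (lerD (lerD (ler_normB _ _) (lexx _)) (lexx _))).
rewrite /= in sx' sy'; lra.
Qed.

(** Off the boundaries of the closed sets of [closed_oscillation_le], a bound on
    the oscillation of [F s] near [x] extends to [F u] for [u] near [s], which
    turns closeness of [F u] and [F s] somewhere near [x] into closeness at
    [x]. *)
Lemma comeagre_continuity (J : countType) (U : J -> set X) :
  (forall j, open (U j)) ->
  (forall x V, nbhs x V -> exists2 j, U j x & U j `<=` V) ->
  exists2 T : set S, comeagre T &
    forall s, T s -> forall x, F u x @[u --> s] --> F s x.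
Proof.
move=> oU baseU.
pose bd (i : J * nat) :=
  let A := oscillation_le F (U i.1) i.2.+1%:R^-1 in A `\` A°.
exists (~` \bigcup_i bd i).
  rewrite /comeagre setCK; apply: meagre_bigcup_countType => -[j k].
  by apply: nowhere_dense_closed_boundary; exact: closed_oscillation_le.
move=> s Ts x; apply/cvgrPdist_lt => e e0.
have [k ke] : exists k, (k.+1%:R^-1 : R) < e / 4.
  have e4 : 0 < e / 4 by rewrite divr_gt0.
  by have [k _ /(_ k (leqnn _))] := near_infty_natSinv_lt (PosNum e4); exists k.
have k0 : 0 < (k.+1%:R^-1 : R) / 2 by rewrite divr_gt0.
have /cvgrPdist_lt/(_ _ k0)/baseU[j Ujx Uj] := @cF s x.
have As : oscillation_le F (U j) k.+1%:R^-1 s.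
  move=> y z /Uj /= sy /Uj /= sz.
  have -> : F s y - F s z = (F s x - F s z) - (F s x - F s y) by ring.
  by rewrite (le_trans (ler_normB _ _))// [leRHS]splitr lerD// ltW.
(* [s] lies in this set but not on its boundary, hence in its interior. *)
have nA : \forall u \near s, oscillation_le F (U j) k.+1%:R^-1 u.
  by apply: contrapT => nA; apply: Ts; exists (j, k).
near=> u.
have Au : oscillation_le F (U j) k.+1%:R^-1 u by near: u; exact: nA.
have [y Ujy uy] : exists2 y, U j y & `|F u y - F s y| < e / 4.
  near: u; apply: (@locF _ x); first by rewrite divr_gt0.
  exact: open_nbhs_nbhs.
have -> : F s x - F u x =
  (F s x - F s y) - (F u y - F s y) - (F u x - F u y) by ring.
rewrite (le_lt_trans (ler_normB _ _))//.
rewrite (le_lt_trans (lerD (ler_normB _ _) (lexx _)))//.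
have := As _ _ Ujx Ujy; have := Au _ _ Ujx Ujy.
move: ke uy.
move: `|F u x - F u y| `|F u y - F s y| `|F s x - F s y| => a b c.
move: (k.+1%:R^-1) => d.
lra.
Unshelve. all: by end_near. Qed.

End dense_continuity.

(** * Closeness in L^p *)

(** Chebyshev's inequality: if [`|g|] is at least [eta] on [V] and [c] is a
    positive real with [c <= mu V], then the seminorm of [g] is at least
    [eta * c `^ p^-1]. *)
Lemma Lfun_seminorm_small d (T : measurableType d) (R : realType)
    (mu : {measure set T -> \bar R}) (p : R) (p1 : (1 <= p%:E)%E)
    (V : set T) (eta : R) :
  measurable V -> (0 < mu V)%E -> 0 < eta ->
  exists2 e : R, 0 < e & forall g : LfunType mu p1,
    Lfun_seminorm g < e -> exists2 y, V y & `|g y| < eta.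
Proof.
move=> mV muV eta0.
have p0 : 0 < p by rewrite (lt_le_trans ltr01)// -lee_fin.
(* [mu V] may be infinite, so it is replaced by a finite lower bound [c]. *)
have [c c0 cV] : exists2 c : R, 0 < c & (c%:E <= mu V)%E.
  move: muV; case: (mu V) => [r|_|//]; first by exists r; rewrite -?lte_fin.
  by exists 1; rewrite ?leey.
exists (eta * c `^ p^-1); first by rewrite mulr_gt0// powR_gt0.
move=> g gs; apply: contrapT => /forall2NP gV.
have {}gV y : V y -> eta <= `|g y|.
  by move=> Vy; have [//|/negP] := gV y; rewrite -leNgt.
have mg : measurable_fun setT (fun y => `|(g y)%:E| `^ p)%E.
  apply: (measurableT_comp (measurable_poweR p)).
  by do 2 apply: measurableT_comp => //.
suff : ((eta `^ p * c)%:E <= (Lfun_seminorm g `^ p)%:E)%E.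
  apply/negP; rewrite -ltNge lte_fin.
  have -> : eta `^ p * c = (eta * c `^ p^-1) `^ p.
    by rewrite powRM ?powR_ge0 ?(ltW eta0)// -powRrM mulVf ?gt_eqF// powRr1 ?ltW.
  apply: gt0_ltr_powR => //.
    by rewrite nnegrE /Lfun_seminorm fine_ge0// Lnorm_ge0.
  by rewrite nnegrE mulr_ge0 ?powR_ge0 ?ltW.
rewrite -poweR_EFin (finite_norm_fine g) poweR_Lnorm ?gt_eqF//.
apply: (@le_trans _ _ (\int[mu]_(x in V) `|(g x)%:E| `^ p)%E); last first.
  by apply: ge0_subset_integral => // y _; exact: poweR_ge0.
apply: (@le_trans _ _ (\int[mu]_(x in V) (eta `^ p)%:E)%E).
  by rewrite integral_cst// EFinM lee_pmul2l// lte_fin powR_gt0.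
apply: ge0_le_integral => //.
- by move=> y _; rewrite lee_fin powR_ge0.
- exact: measurable_funS mg.
- move=> y Vy; rewrite lee_fin.
  by rewrite ge0_ler_powR ?nnegrE ?(ltW p0) ?(ltW eta0)//; exact: gV.
Qed.

(** * The unit interval *)

Section unit_interval.
Variable R : realType.
Local Notation I := (unit_interval R).
Local Notation val := (@unit_interval_val R).

Lemma unit_interval_nbhsP (x : I) (V : set I) :
  nbhs x V <-> exists2 e : R, 0 < e & val @^-1` ball (val x) e `<=` V.
Proof. by rewrite -nbhs_ballE; split=> -[e e0 eV]; exists e. Qed.

Lemma unit_interval_val_continuous : continuous val.
Proof. exact: initial_continuous. Qed.

Lemma unit_interval_measure_nbhs_gt0 (x : I) (V : set I) :
  nbhs x V -> (0 < unit_interval_measure V)%E.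
Proof.
move=> /unit_interval_nbhsP[e e0 eV].
have /andP[x0 x1] : 0 <= val x <= 1.
  by have /set_mem := valP x; rewrite /= in_itv.
(* When [x] is an end point, only one side of the ball lies in [[0, 1]]. *)
pose a := Num.max 0 (val x - e / 2); pose b := Num.min 1 (val x + e / 2).
have ab : a < b.
  rewrite /a /b gt_max !lt_min; apply/andP; split; apply/andP; split; lra.
apply: (@lt_le_trans _ _ (lebesgue_measure (`]a, b[%classic : set R))).
  by rewrite lebesgue_measure_itv /= lte_fin ab -EFinB lte_fin subr_gt0.
apply: le_outer_measure => y /=; rewrite in_itv/= gt_max lt_min.
move=> /andP[/andP[y0 ey] /andP[y1 ye]].
have yI : y \in (`[0, 1]%classic : set R) by rewrite inE /= in_itv /= !ltW.
exists (exist _ y yI) => //; apply: eV.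
suff : `|val x - y| < e by [].
rewrite ltr_norml; lra.
Qed.

Definition rat_interval (i : rat * rat) : set I :=
  val @^-1` `]ratr i.1, ratr i.2[%classic.

Lemma open_rat_interval i : open (rat_interval i).
Proof.
apply: open_comp => [x _|]; first exact: unit_interval_val_continuous.
exact: interval_open.
Qed.

Lemma rat_interval_base (x : I) (V : set I) :
  nbhs x V -> exists2 i, rat_interval i x & rat_interval i `<=` V.
Proof.
move=> /unit_interval_nbhsP[e e0 eV].
have [q] : exists q : rat, ratr q \in `](val x - e), (val x)[.
  by apply: rat_in_itvoo; lra.
have [r] : exists q : rat, ratr q \in `](val x), (val x + e)[.
  by apply: rat_in_itvoo; lra.
rewrite !in_itv /= => /andP[xr re] /andP[eq qx].
exists (q, r); first by rewrite /rat_interval /= in_itv /= qx.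
move=> y; rewrite /rat_interval /= in_itv /= => /andP[qy yr].
apply: eV; suff : `|val x - val y| < e by [].
rewrite ltr_norml; lra.
Qed.

End unit_interval.

Theorem proposition3p1 (R : realType) (p : R) (p1 : (1 <= p%:E)%E)
    (f : unit_interval R -> LfunType (@unit_interval_measure R) p1) :
  continuous f ->
  (forall t : unit_interval R, continuous (f t : unit_interval R -> R)) ->
  exists2 T : set (unit_interval R), comeagre T &
    forall t : unit_interval R, T t ->
    forall t_ : (unit_interval R)^nat, t_ n @[n --> \oo] --> t ->
    forall x : unit_interval R, f (t_ n) x @[n --> \oo] --> f t x.
Proof.
move=> cf cft.
pose F (t x : unit_interval R) : R := f t x.
have locF (t x : unit_interval R) (V : set (unit_interval R)) (eta : R) :
    0 < eta -> nbhs x V ->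
    \forall u \near t, exists2 y, V y & `|F u y - F t y| < eta.
  move=> eta0 xV.
  have mV : measurable V° by apply: sub_sigma_algebra; exact: open_interior.
  have muV : (0 < unit_interval_measure V°)%E.
    exact: unit_interval_measure_nbhs_gt0 (nbhs_interior xV).
  have [e e0 eP] := Lfun_seminorm_small p1 mV muV eta0.
  have near_e : \forall u \near t, ball (f t) e (f u).
    exact: cf t _ (nbhsx_ballx (f t) e e0).
  apply: filterS near_e => u /eP[y /interior_subset Vy tu].
  by exists y => //; rewrite distrC.
have [T cT TP] := comeagre_continuity cft locF
  (@open_rat_interval R) (@rat_interval_base R).
exists T => // t Tt t_ t_t x.
exact: cvg_comp t_t (TP t Tt x).
Qed.
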